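(* Let $(X,f)$ be a dynamical system, $\varphi:\mathbb N\to(0,1]$ a function, and $\mathcal Z=\{z_i\}_{i=0}^\infty\subset X$ a sequence of points. Let $\underline\tau:=\liminf_{n\to\infty}-\frac{\ln\varphi(n)}{n}$. (1) Assume $(X,f)$ is $L$-Lipschitz. Then $$h_{top}(f,\mathfrak S(f,\varphi,\mathcal Z,\mathbb N))\le\Big(1-\frac{\underline\tau}{\ln L+\underline\tau}\Big)h_{top}(f,X).$$ If further $f$ is $\lambda$-hyperbolic, then $$\dim_H\mathfrak S(f,\varphi,\mathcal Z,\mathbb N)\le\frac1\lambda\Big(1-\frac{\underline\tau}{\ln L+\underline\tau}\Big)h_{top}(f,X).$$ (2) Assume $(X,f)$ is an $(L_1,L_2)$-bi-Lipschitz homeomorphism. (2.1) If $\ln L_1>\underline\tau$, then $$h_{top}(f,\mathfrak S(f,\varphi,\mathcal Z,\mathbb N))\le\frac{\ln L_1\ln L_2-\underline\tau\ln L_2}{\ln L_1\ln L_2+\underline\tau\ln L_1}\,h_{top}(f,X).$$ If further $f$ is $(\lambda_1,\lambda_2)$-hyperbolic, then $$\dim_H\mathfrak S(f,\varphi,\mathcal Z,\mathbb N)\le\Big(\frac1{\lambda_1}+\frac1{\lambda_2}\,\frac{\ln L_1\ln L_2-\underline\tau\ln L_2}{\ln L_1\ln L_2+\underline\tau\ln L_1}\Big)h_{top}(f,X).$$ (2.2) If $\ln L_1=\underline\tau$, then $h_{top}(f,\mathfrak S(f,\varphi,\mathcal Z,\mathbb N))=0$. If further $f$ is $(\lambda_1,\lambda_2)$-hyperbolic,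 then $\dim_H\mathfrak S(f,\varphi,\mathcal Z,\mathbb N)\le\frac1{\lambda_1}h_{top}(f,X)$. (2.3) If $\ln L_1<\underline\tau$, then $h_{top}(f,\mathfrak S(f,\varphi,\mathcal Z,\mathbb N))=0$. If further $f$ is $(\lambda_1,\lambda_2)$-hyperbolic, then $\dim_H\mathfrak S(f,\varphi,\mathcal Z,\mathbb N)=0$.
   Context: $\mathbb N$ is the set of non-negative integers. A dynamical system $(X,f)$ consists of a compact metric space $(X,d)$ with at least two points and a continuous map $f:X\to X$. Shrinking target set: $\mathfrak S(f,\varphi,\mathcal Z,\mathbb N):=\{x\in X: d(f^n(x),z_n)<\varphi(n)\text{ for infinitely many }n\in\mathbb N\}$. Lipschitz conditions: $f$ is $L$-Lipschitz if $\sup_{x\ne y}\frac{d(f(x),f(y))}{d(x,y)}\le L<\infty$. $f$ is an $(L_1,L_2)$-bi-Lipschitz homeomorphism if it is a homeomorphism with $\sup_{x\neq y}\frac{d(f^{-1}(x),f^{-1}(y))}{d(x,y)}\le L_1<\infty$ and $\sup_{x\neq y}\frac{d(f(x),f(y))}{d(x,y)}\le L_2<\infty$. Dynamical ball: $B_n(x,\varepsilon,f)=\{y\in X: d(f^i(x),f^i(y))<\varepsilon,\ 0\le i\le n-1\}$, $n\ge1$. $\lambda$-hyperbolic ($\lambda>0$): for any $\varepsilon_h>0$ there is $0<\varepsilon\le\varepsilon_h$ such that for all $x\in X$ and $n\ge1$, every $y\in B_n(x,\varepsilon,f)$ satisfies $d(f^i(x),f^i(y))<\varepsilon_h e^{-(n-1-i)\lambda}$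 for all $0\le i\le n-1$. $(\lambda_1,\lambda_2)$-hyperbolic ($\lambda_1,\lambda_2>0$): for any $\varepsilon_h>0$ there is $0<\varepsilon\le\varepsilon_h$ such that for all $x\in X$ and $n\ge1$, every $y\in B_n(x,\varepsilon,f)$ satisfies $d(f^i(x),f^i(y))<\varepsilon_h e^{-\min\{i\lambda_1,(n-1-i)\lambda_2\}}$ for all $0\le i\le n-1$. Bowen topological entropy of a subset $Z\subseteq X$: for $s\ge0$, $M\ge 1$, $\varepsilon>0$ let $\mathcal M^s_{M,\varepsilon}(Z)=\inf\sum_i e^{-sn_i}$ over finite or countable families $\{B_{n_i}(x_i,\varepsilon,f)\}$ covering $Z$ with $x_i\in X$, $n_i\ge M$; $\mathcal M^s_\varepsilon(Z)=\lim_{M\to\infty}\mathcal M^s_{M,\varepsilon}(Z)$; $h_{top}(f,Z,\varepsilon)=\inf\{s:\mathcal M^s_\varepsilon(Z)=0\}$; $h_{top}(f,Z)=\lim_{\varepsilon\to0}h_{top}(f,Z,\varepsilon)$. For $Z=X$ this is the classical topological entropy. $\dim_H$ is Hausdorff dimension with respect to $d$. When $\underline\tau=+\infty$, the factor $1-\frac{\underline\tau}{\ln L+\underline\tau}$ is read as its limiting value $0$. *)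

(* Defs.v *)
From HB Require Import structures.
From mathcomp Require Import all_boot all_order all_algebra.
From mathcomp Require Import all_classical all_reals all_analysis.

Set Implicit Arguments.
Unset Strict Implicit.
Unset Printing Implicit Defensive.

Import Order.TTheory GRing.Theory Num.Theory.
Import numFieldNormedType.Exports.

Local Open Scope classical_set_scope.
Local Open Scope ring_scope.

Section Definitions.
Context {R : realType} {X : metricType R}.
Implicit Types (f : X -> X) (Z : set X) (phi : nat -> R).

Definition shrinking_target f phi (z : nat -> X) : set X :=
  [set x | infinite_set [set n : nat | mdist (iter n f x) (z n) < phi n]].

(* The term of index 0, where the quotient is a division by zero, does not
   affect the lower limit. *)
Definition lower_decay_rate phi : \bar R :=
  limn_einf (fun n : nat => (- (ln (phi n) / n%:R))%:E).

Definition lipschitz_const f : \bar R :=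
  ereal_sup [set (mdist (f p.1) (f p.2) / mdist p.1 p.2)%:E
            | p in [set p : X * X | p.1 <> p.2]].

Definition lipschitz_map (L : R) f : Prop := (lipschitz_const f <= L%:E)%E.

Definition bilipschitz_homeo (L1 L2 : R) f : Prop :=
  exists g : X -> X,
    [/\ cancel f g, cancel g f, continuous f & continuous g] /\
    (lipschitz_const g <= L1%:E)%E /\ (lipschitz_const f <= L2%:E)%E.

Definition bowen_ball f (n : nat) (x : X) (eps : R) : set X :=
  [set y | forall i : nat, (i < n)%N ->
     mdist (iter i f x) (iter i f y) < eps].

Definition hyperbolic (lambda : R) f : Prop :=
  forall eh : R, 0 < eh ->
  exists eps : R, [/\ 0 < eps, eps <= eh &
    forall (x : X) (n : nat), (1 <= n)%N ->
    forall y, bowen_ball f n x eps y ->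
    forall i : nat, (i <= n.-1)%N ->
      mdist (iter i f x) (iter i f y) <
        eh * expR (- ((n.-1 - i)%:R * lambda))].

Definition hyperbolic2 (lambda1 lambda2 : R) f : Prop :=
  forall eh : R, 0 < eh ->
  exists eps : R, [/\ 0 < eps, eps <= eh &
    forall (x : X) (n : nat), (1 <= n)%N ->
    forall y, bowen_ball f n x eps y ->
    forall i : nat, (i <= n.-1)%N ->
      mdist (iter i f x) (iter i f y) <
        eh * expR (- Num.min (i%:R * lambda1) ((n.-1 - i)%:R * lambda2))].

(* A finite or countable family of dynamical balls is indexed by an arbitrary
   (possibly empty) set I of natural numbers. Balls of order 0 are excluded as
   soon as M >= 1, and only the limit M -> oo is used below. *)
Definition bowen_premeasure f (s eps : R) Z (M : nat) : \bar R :=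
  ereal_inf [set r | exists (I : set nat) (c : nat -> X) (n : nat -> nat),
    [/\ forall i, I i -> (M <= n i)%N,
        Z `<=` \bigcup_(i in I) bowen_ball f (n i) (c i) eps &
        r = \esum_(i in I) (expR (- (s * (n i)%:R)))%:E]].

Definition bowen_measure f (s eps : R) Z : \bar R :=
  lim (bowen_premeasure f s eps Z M @[M --> \oo]).

Definition htop_scale f Z (eps : R) : \bar R :=
  ereal_inf [set s%:E | s in [set s : R |
    0 <= s /\ bowen_measure f s eps Z = 0%E]].

Definition htop f Z : \bar R := lim (htop_scale f Z eps @[eps --> 0^'+]).

(* The element 0 makes the diameter of the empty set equal to 0. *)
Definition diameter (U : set X) : \bar R :=
  ereal_sup ([set 0%E] `|` [set (mdist p.1 p.2)%:E | p in U `*` U]).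

Definition hausdorff_premeasure (s : R) Z (delta : R) : \bar R :=
  ereal_inf [set r | exists (I : set nat) (U : nat -> set X),
    [/\ forall i, I i -> (diameter (U i) <= delta%:E)%E,
        Z `<=` \bigcup_(i in I) U i &
        r = \esum_(i in I) (diameter (U i) `^ s)%E]].

Definition hausdorff_measure (s : R) Z : \bar R :=
  lim (hausdorff_premeasure s Z delta @[delta --> 0^'+]).

Definition hausdorff_dim Z : \bar R :=
  ereal_inf [set s%:E | s in [set s : R |
    0 <= s /\ hausdorff_measure s Z = 0%E]].

End Definitions.

(* 1 - tau / (ln L + tau), with its limiting value 0 at tau = +oo. The value at
   tau = -oo is irrelevant: lower_decay_rate phi >= 0 when phi <= 1. If
   ln L <= 0, where the denominator may vanish, the map is non-expanding, so
   this factor only ever multiplies a zero entropy. *)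
Definition lipschitz_factor {R : realType} (L : R) (tau : \bar R) : R :=
  if tau is t%:E then 1 - t / (ln L + t) else 0.

(* If the denominator vanishes although ln L1 > tau >= 0, then L2 = 1, the map
   is an isometry and this factor only ever multiplies a zero entropy. *)
Definition bilipschitz_factor {R : realType} (L1 L2 tau : R) : R :=
  (ln L1 * ln L2 - tau * ln L2) / (ln L1 * ln L2 + tau * ln L1).

(* Main.v *)
Require Import Defs.
From HB Require Import structures.
From mathcomp Require Import all_boot all_order all_algebra.
From mathcomp Require Import all_classical all_reals all_analysis.
From mathcomp Require Import lra ring zify.

Set Implicit Arguments.
Unset Strict Implicit.
Unset Printing Implicit Defensive.

Import Order.TTheory GRing.Theory Num.Theory.
Import numFieldNormedType.Exports.

Local Open Scope classical_set_scope.
Local Open Scope ring_scope.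

(* If the orbit of x is within phi(n) ~ e^(-tau n) of z_n at time n, the Lipschitz
   bounds keep f^i(x) close to the orbit of z_n for all i between
   (1 - tau / ln L1) n and (1 + tau / ln L2) n. Hence, at a fixed scale, the points
   hitting the n-th target are covered by dynamical balls of order
   (1 + tau / ln L2) n whose number is that of the balls of order
   (1 - tau / ln L1) n covering X; the ratio of the two orders bounds the entropy
   of the limsup set. Hyperbolicity turns dynamical balls into sets of small
   diameter, which bounds the Hausdorff dimension.
   When the Lipschitz constant of f or of its inverse is at most 1, the numbers
   of balls stay bounded and the entropy of X vanishes. *)

(** * Bowen and Hausdorff premeasures, entropy and dimension: monotonicity and upper bounds *)

Section Premeasures.
Context {R : realType} {X : metricType R}.
Implicit Types (f : X -> X) (Z : set X).

Lemma bowen_premeasure_nondecreasing f s eps Z :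
  nondecreasing_seq (bowen_premeasure f s eps Z).
Proof.
move=> M M' MM'; apply: ereal_inf_le_tmp => _ [I [c [n [nM cov ->]]]].
by exists I, c, n; split => // i /nM; exact: leq_trans.
Qed.

Lemma bowen_premeasure_ge0 f s eps Z M : (0 <= bowen_premeasure f s eps Z M)%E.
Proof.
apply: le_ereal_inf_tmp => _ [I [c [n [_ _ ->]]]].
by apply: esum_ge0 => i _; rewrite lee_fin expR_ge0.
Qed.

Lemma bowen_measureE f s eps Z :
  bowen_measure f s eps Z = ereal_sup (range (bowen_premeasure f s eps Z)).
Proof.
apply/cvg_lim => //; apply: ereal_nondecreasing_cvgn.
exact: bowen_premeasure_nondecreasing.
Qed.

Lemma bowen_measure_ge0 f s eps Z : (0 <= bowen_measure f s eps Z)%E.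
Proof.
rewrite bowen_measureE; apply: le_trans (bowen_premeasure_ge0 f s eps Z 0) _.
by apply: ereal_sup_ubound; exists 0%N.
Qed.

Lemma bowen_measure_eq0 f s eps Z :
  (forall M e, 0 < e -> (bowen_premeasure f s eps Z M <= e%:E)%E) ->
  bowen_measure f s eps Z = 0%E.
Proof.
move=> small; apply/eqP; rewrite eq_le bowen_measure_ge0 andbT bowen_measureE.
apply: ge_ereal_sup => _ [M _ <-].
by apply/lee_addgt0Pr => e e0; rewrite add0e small.
Qed.

Lemma le_bowen_measure f s eps eps' Z Z' : eps <= eps' -> Z' `<=` Z ->
  (bowen_measure f s eps' Z' <= bowen_measure f s eps Z)%E.
Proof.
move=> ee ZZ; rewrite !bowen_measureE; apply: ge_ereal_sup => _ [M _ <-].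
apply: (@le_trans _ _ (bowen_premeasure f s eps Z M)); last first.
  by apply: ereal_sup_ubound; exists M.
apply: ereal_inf_le_tmp => _ [I [c [n [nM cov ->]]]]; exists I, c, n; split => //.
move=> x /ZZ /cov[i Ii xi]; exists i => // j jn.
by apply: lt_le_trans ee; exact: xi.
Qed.

Lemma htop_scale_ge0 f Z eps : (0 <= htop_scale f Z eps)%E.
Proof. by apply: le_ereal_inf_tmp => _ [s [s0 _] <-]; rewrite lee_fin. Qed.

Lemma le_htop_scale f eps eps' Z Z' : eps <= eps' -> Z' `<=` Z ->
  (htop_scale f Z' eps' <= htop_scale f Z eps)%E.
Proof.
move=> ee ZZ; apply: ereal_inf_le_tmp => _ [s [s0 m0] <-]; exists s => //.
split=> //; apply/eqP; rewrite eq_le bowen_measure_ge0 andbT -m0.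
exact: le_bowen_measure.
Qed.

Lemma htop_scale_le f Z eps s : 0 <= s ->
  (forall t, s < t -> bowen_measure f t eps Z = 0%E) ->
  (htop_scale f Z eps <= s%:E)%E.
Proof.
move=> s0 null; apply/lee_addgt0Pr => e e0.
apply: ereal_inf_lbound; exists (s + e) => //; split; first by rewrite addr_ge0// ltW.
by apply: null; rewrite ltrDl.
Qed.

Lemma htopE f Z :
  htop f Z = ereal_sup (htop_scale f Z @` [set` `]0, +oo[ ]).
Proof.
apply/cvg_lim => //; apply: nonincreasing_at_right_cvge => // x y _ _ xy.
exact: le_htop_scale.
Qed.

Lemma htop_scale_le_htop f Z eps : 0 < eps -> (htop_scale f Z eps <= htop f Z)%E.
Proof.
move=> e0; rewrite htopE; apply: ereal_sup_ubound; exists eps => //.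
by rewrite /= in_itv/= e0.
Qed.

Lemma htop_le f Z (h : \bar R) :
  (forall eps, 0 < eps -> (htop_scale f Z eps <= h)%E) -> (htop f Z <= h)%E.
Proof.
move=> le_h; rewrite htopE; apply: ge_ereal_sup => _ [eps + <-].
by rewrite /= in_itv/= andbT; exact: le_h.
Qed.

Lemma htop_ge0 f Z : (0 <= htop f Z)%E.
Proof. exact: le_trans (htop_scale_ge0 f Z 1) (htop_scale_le_htop _ _ ltr01). Qed.

Lemma le_htop f Z Z' : Z' `<=` Z -> (htop f Z' <= htop f Z)%E.
Proof.
move=> ZZ; apply: htop_le => eps e0.
exact: le_trans (le_htop_scale f (lexx eps) ZZ) (htop_scale_le_htop _ _ e0).
Qed.

Lemma diameter_ge0 (U : set X) : (0 <= diameter U)%E.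
Proof. by apply: ereal_sup_ubound; left. Qed.

Lemma diameter_le (U : set X) (r : R) : 0 <= r ->
  (forall x y, U x -> U y -> mdist x y <= r) -> (diameter U <= r%:E)%E.
Proof.
move=> r0 Ur; apply: ge_ereal_sup => _ [->|[[x y] [/= Ux Uy] <-]].
  by rewrite lee_fin.
by rewrite lee_fin Ur.
Qed.

Lemma hausdorff_premeasure_ge0 s Z delta :
  (0 <= hausdorff_premeasure s Z delta)%E.
Proof.
apply: le_ereal_inf_tmp => _ [I [U [_ _ ->]]].
by apply: esum_ge0 => i _; exact: poweR_ge0.
Qed.

Lemma hausdorff_measure_eq0 s Z :
  (forall delta e, 0 < delta -> 0 < e ->
    (hausdorff_premeasure s Z delta <= e%:E)%E) ->
  hausdorff_measure s Z = 0%E.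
Proof.
move=> small.
have null delta : 0 < delta -> hausdorff_premeasure s Z delta = 0%E.
  move=> d0; apply/eqP; rewrite eq_le hausdorff_premeasure_ge0 andbT.
  by apply/lee_addgt0Pr => e e0; rewrite add0e small.
apply/cvg_lim => //; apply: cvg_near_cst.
by near=> delta; apply: null; near: delta; exact: nbhs_right_gt.
Unshelve. all: by end_near. Qed.

Lemma hausdorff_dim_ge0 Z : (0 <= hausdorff_dim Z)%E.
Proof. by apply: le_ereal_inf_tmp => _ [s [s0 _] <-]; rewrite lee_fin. Qed.

Lemma hausdorff_dim_le Z s : 0 <= s ->
  (forall t, s < t -> hausdorff_measure t Z = 0%E) ->
  (hausdorff_dim Z <= s%:E)%E.
Proof.
move=> s0 null; apply/lee_addgt0Pr => e e0.
apply: ereal_inf_lbound; exists (s + e) => //; split; first by rewrite addr_ge0// ltW.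
by apply: null; rewrite ltrDl.
Qed.

(** Transport along [pickle] admits covers indexed by any countable type, so that pairs of a level
    and a label can serve as indices; [x0] is a default centre. *)
Lemma bowen_premeasure_le (T : countType) f s eps Z M (x0 : X)
    (I : set T) (c : T -> X) (n : T -> nat) :
  (forall i, I i -> (M <= n i)%N) ->
  Z `<=` \bigcup_(i in I) bowen_ball f (n i) (c i) eps ->
  (bowen_premeasure f s eps Z M <=
    \esum_(i in I) (expR (- (s * (n i)%:R)))%:E)%E.
Proof.
move=> nM cov; apply: ereal_inf_lbound.
exists (pickle @` I), (fun k => oapp c x0 (unpickle k)),
  (fun k => oapp n 0%N (unpickle k)); split.
- by move=> _ [i Ii <-]; rewrite pickleK/= nM.
- move=> x /cov[i Ii xi]; exists (pickle i); first by exists i.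
  by rewrite pickleK.
- rewrite esum_image; first by apply: eq_esum => i _; rewrite pickleK.
  by move=> i j _ _; exact: (pcan_inj pickleK).
Qed.

Lemma hausdorff_premeasure_le (T : countType) s Z delta
    (I : set T) (U : T -> set X) :
  (forall i, I i -> (diameter (U i) <= delta%:E)%E) ->
  Z `<=` \bigcup_(i in I) U i ->
  (hausdorff_premeasure s Z delta <= \esum_(i in I) (diameter (U i) `^ s))%E.
Proof.
move=> Ud cov; apply: ereal_inf_lbound.
exists (pickle @` I), (fun k => oapp U set0 (unpickle k)); split.
- by move=> _ [i Ii <-]; rewrite pickleK/= Ud.
- move=> x /cov[i Ii xi]; exists (pickle i); first by exists i.
  by rewrite pickleK.
- rewrite esum_image; first by apply: eq_esum => i _; rewrite pickleK.
  by move=> i j _ _; exact: (pcan_inj pickleK).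
Qed.

End Premeasures.

(** * Exponential decay and tails of geometric series *)

Lemma exp_decay {R : realType} (D b e : R) : 0 < b -> 0 < e ->
  exists N, forall n, (N <= n)%N -> D * expR (- (b * n%:R)) <= e.
Proof.
move=> b0 e0.
have : (fun n => D * expR (- b) ^+ n) @ \oo --> D * 0.
  apply: cvgMr; apply: cvg_expr.
  by rewrite gtr0_norm ?expR_gt0// expR_lt1 oppr_lt0.
rewrite mulr0 => /cvgrPdist_le/(_ _ e0)[N _ Ne]; exists N => n Nn.
rewrite -mulNr expRM_natr; apply: le_trans (ler_norm _) _.
by have := Ne n Nn; rewrite sub0r normrN.
Qed.

(** A pair [(n, j)] stands for the [j]-th of [K n] covering pieces at level [n], each of weight
    [a n]. The weight of a level is dominated by a geometric sequence, whose tails tend to 0. *)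
Lemma esum_geometric_tail {R : realType} (K : nat -> nat) (a : nat -> R)
    (C d : R) (N0 : nat) :
  0 < d -> (forall n, 0 <= a n) ->
  (forall n, (N0 <= n)%N -> (K n)%:R * a n <= C * expR (- (d * n%:R))) ->
  forall (N1 : nat) (e : R), 0 < e -> exists2 N, (N1 <= N)%N &
    (\esum_(p in [set n | (N <= n)%N] `*`` (fun n => `I_(K n))) (a p.1)%:E
      <= e%:E)%E.
Proof.
move=> d0 a0 Ka N1 e e0; pose q := expR (- d).
have q01 : 0 < q < 1 by rewrite expR_gt0 expR_lt1 oppr_lt0.
have qE n : expR (- (d * n%:R)) = q ^+ n by rewrite -mulNr expRM_natr.
have C0 : 0 <= C.
  have : 0 <= C * expR (- (d * N0%:R)) by apply: le_trans (Ka _ (leqnn _)); rewrite mulr_ge0.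
  by rewrite pmulr_lge0// expR_gt0.
have [N' N'e] := exp_decay (C / (1 - q)) d0 e0.
pose N := maxn N' (maxn N0 N1).
have [NN1 NN0] : (N1 <= N)%N /\ (N0 <= N)%N by rewrite /N; lia.
have Ne : C * (q ^+ N / (1 - q)) <= e.
  by rewrite mulrA mulrAC -qE N'e// leq_maxl.
exists N => //.
rewrite -(@esum_esum _ _ _ [set n | (N <= n)%N] (fun n => `I_(K n)) (fun n _ => (a n)%:E))//=; last first.
  by move=> i j _ _; rewrite lee_fin.
have -> : \esum_(n in [set n | (N <= n)%N]) \esum_(j in `I_(K n)) (a n)%:E =
    \esum_(n in [set n | (N <= n)%N]) ((K n)%:R * a n)%:E.
  apply: eq_esum => n _; rewrite esum_fset//=; last by move=> i _; rewrite lee_fin.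
  rewrite fsbig_finite//=.
  rewrite sumEFin big_const_seq count_predT (@card_fset_set _ _ (K n)) ?card_eqxx//.
  by rewrite iter_addr addr0 mulr_natl.
apply: (@le_trans _ _ (\esum_(n in [set n | (N <= n)%N]) (C * q ^+ n)%:E)).
  by apply: le_esum => n /= Nn; rewrite lee_fin -qE Ka// (leq_trans NN0).
rewrite -(@nneseries_esum _ _ (fun n => N <= n)%N); last first.
  by move=> n _; rewrite lee_fin mulr_ge0// exprn_ge0//; lra.
apply: lime_le; first by apply: is_cvg_nneseries => n _ _; rewrite lee_fin mulr_ge0// exprn_ge0//; lra.
apply: nearW => m; rewrite sumEFin lee_fin -mulr_sumr.
apply: le_trans Ne; rewrite ler_wpM2l//.
(* Closed form of the partial sum from [N] to [m]; the maximum covers the empty sum when [m < N]. *)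
apply: (@le_trans _ _ ((q ^+ N - q ^+ maxn m N) / (1 - q))); last first.
  by rewrite ler_pM2r ?invr_gt0; [rewrite gerBl exprn_ge0//; lra|lra].
rewrite ler_pdivlMr; last lra.
elim: m => [|m IH]; first by rewrite max0n subrr big_geq// mul0r.
rewrite big_mkcond/= big_nat_recr//= -big_mkcond/= mulrDl.
case: ifPn => Nm.
  move: IH; rewrite (maxn_idPl Nm) (_ : maxn m.+1 N = m.+1); last lia.
  by rewrite exprS; lra.
by move: IH; rewrite mul0r addr0 (_ : maxn m.+1 N = maxn m N)//; lia.
Qed.

(* A partition of [E] into at most [w] classes, encoded by a labelling of the
   points; [w] is real because it is compared with exponentials. *)
Definition few_classes {R : realType} {T : Type} (E : set T)
    (r : T -> T -> Prop) (w : R) :=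
  exists (K : nat) (c : T -> nat), [/\ K%:R <= w,
    forall x, E x -> (c x < K)%N &
    forall x y, E x -> E y -> c x = c y -> r x y].

(** * Operations on labelled partitions *)

Section FewClasses.
Context {R : realType} {T : Type}.
Implicit Types (E : set T) (r : T -> T -> Prop) (w : R).

Lemma few_classes_impl E E' r r' w w' : E' `<=` E -> w <= w' ->
  (forall x y, E' x -> E' y -> r x y -> r' x y) ->
  few_classes E r w -> few_classes E' r' w'.
Proof.
move=> EE ww rr [K [c [Kw cK cr]]]; exists K, c; split.
- exact: le_trans ww.
- by move=> x /EE; exact: cK.
- by move=> x y Ex Ey cxy; apply: rr => //; apply: cr => //; exact: EE.
Qed.

Lemma few_classes_preimage {T' : Type} (h : T -> T') (E : set T')
    (r : T' -> T' -> Prop) w :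
  few_classes E r w -> few_classes (h @^-1` E) (fun x y => r (h x) (h y)) w.
Proof.
move=> [K [c [Kw cK cr]]]; exists K, (c \o h); split => //.
  by move=> x; exact: cK.
by move=> x y Ex Ey /=; exact: cr.
Qed.

Lemma few_classes_and E r r' w w' :
  few_classes E r w -> few_classes E r' w' ->
  few_classes E (fun x y => r x y /\ r' x y) (w * w').
Proof.
move=> [K [c [Kw cK cr]]] [K' [c' [Kw' cK' cr']]].
(* The pair of labels is written as one number with last digit [c' x] in base [K']. *)
exists (K * K')%N, (fun x => c x * K' + c' x)%N; split.
- by rewrite natrM ler_pM.
- by move=> x Ex; have := cK x Ex; have := cK' x Ex; nia.
move=> x y Ex Ey cxy.
have c'xy : c' x = c' y.
  by have := congr1 (modn^~ K') cxy; rewrite !modnMDl !modn_small ?cK'.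
split; [apply: cr => //|exact: cr'].
by have := cK' x Ex; move: cxy; rewrite c'xy; nia.
Qed.

Lemma few_classesU E E' r w w' : few_classes E r w -> few_classes E' r w' ->
  few_classes (E `|` E') r (w + w').
Proof.
move=> [K [c [Kw cK cr]]] [K' [c' [Kw' cK' cr']]].
exists (K + K')%N, (fun x => if `[< E x >] then c x else K + c' x)%N; split.
- by rewrite natrD lerD.
- move=> x; case: asboolP => [Ex _|nEx [//|E'x]].
    by have := cK x Ex; lia.
  by rewrite ltn_add2l cK'.
move=> x y; case: asboolP => [Ex _|nEx [//|E'x]];
  case: asboolP => [Ey _|nEy [//|E'y]].
- exact: cr.
- by have := cK x Ex; lia.
- by have := cK y Ey; lia.
- by move/eqP; rewrite eqn_add2l => /eqP; exact: cr'.
Qed.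

Lemma few_classes_bigcup (I : eqType) (l : seq I) (E : I -> set T) r
    (w : I -> R) :
  (forall i, i \in l -> few_classes (E i) r (w i)) ->
  few_classes (\bigcup_(i in [set` l]) E i) r (\sum_(i <- l) w i).
Proof.
elim: l => [_|i l IH El].
  rewrite big_nil; exists 0%N, (fun=> 0%N); split => //.
    by move=> x [].
  by move=> x y [].
have -> : \bigcup_(j in [set` i :: l]) E j = E i `|` \bigcup_(j in [set` l]) E j.
  apply/seteqP; split => [x [j /=]|x [Eix|[j /= jl Ejx]]].
  - rewrite in_cons => /orP[/eqP->|jl] Ejx; [by left|by right; exists j].
  - by exists i; rewrite //= mem_head.
  - by exists j; rewrite //= in_cons jl orbT.
rewrite big_cons; apply: few_classesU.
  by apply: El; rewrite mem_head.
by apply: IH => j jl; apply: El; rewrite in_cons jl orbT.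
Qed.

End FewClasses.

(** * Null limsup sets *)

Section NullSets.
Context {R : realType} {X : metricType R}.
Variables (S : set X) (E : nat -> set X) (w : nat -> R) (C d : R) (N0 : nat).
Hypothesis d0 : 0 < d.
Hypothesis S_limsup : forall x, S x -> forall N, exists2 n, (N <= n)%N & E n x.

(** A Borel-Cantelli argument: the classes of [E n] for [n >= N] cover [S], each lies in a ball of
    order [q n] centred at one of its points, and the weights have small tails. The condition
    [n <= q n] pushes the orders beyond any [M]. *)
Lemma bowen_measure_limsup (x0 : X) (f : X -> X) (t eps : R) (q : nat -> nat) :
  (forall n, (N0 <= n)%N -> [/\ (n <= q n)%N,
    few_classes (E n) (fun x y => bowen_ball f (q n) x eps y) (w n) &
    w n * expR (- (t * (q n)%:R)) <= C * expR (- (d * n%:R))]) ->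
  bowen_measure f t eps S = 0%E.
Proof.
move=> H; apply: bowen_measure_eq0 => M e e0.
have /choice[Kc Kc_spec] : forall n, exists Kc : nat * (X -> nat),
    (N0 <= n)%N -> [/\ Kc.1%:R <= w n, forall x, E n x -> (Kc.2 x < Kc.1)%N &
      forall x y, E n x -> E n y -> Kc.2 x = Kc.2 y -> bowen_ball f (q n) x eps y].
  move=> n; case: (leqP N0 n) => [/H[_ [K [c Kc]] _]|_]; last by exists (0%N, fun=> 0%N).
  by exists (K, c).
have Ka n : (N0 <= n)%N ->
    (Kc n).1%:R * expR (- (t * (q n)%:R)) <= C * expR (- (d * n%:R)).
  move=> nN0; have [_ _] := H n nN0; apply: le_trans; rewrite ler_wpM2r ?expR_ge0//.
  by have [] := Kc_spec n nN0.
have [N NM Ne] := esum_geometric_tail d0 (fun n => expR_ge0 _) Ka (maxn N0 M) e0.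
apply: le_trans Ne.
(* A representative of the class, or [x0] if the class is empty. *)
pose ctr (p : nat * nat) := xget x0 [set x | E p.1 x /\ (Kc p.1).2 x = p.2].
apply: (@bowen_premeasure_le _ _ _ f t eps S M x0 _ ctr (fun p => q p.1)).
  move=> [n j] [/= Nn _]; have [|+ _ _] := H n; first lia.
  by lia.
move=> x Sx; have [n Nn Enx] := S_limsup Sx N.
have [|_ cK cr] := Kc_spec n; first lia.
exists (n, (Kc n).2 x) => /=; first by split => //=; exact: cK.
have [Ey cy] : E n (ctr (n, (Kc n).2 x)) /\ (Kc n).2 (ctr (n, (Kc n).2 x)) = (Kc n).2 x.
  by rewrite /ctr; case: xgetP => [y _ [//]|/(_ x)]; case.
exact: cr.
Qed.

(** The same argument with the classes themselves as covering sets, of diameter at most [rad n]. *)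
Lemma hausdorff_measure_limsup (t : R) (rad : nat -> R) : 0 <= t ->
  (forall delta, 0 < delta -> exists N, forall n, (N <= n)%N -> rad n <= delta) ->
  (forall n, (N0 <= n)%N -> [/\ 0 <= rad n,
    few_classes (E n) (fun x y => mdist x y <= rad n) (w n) &
    w n * (rad n `^ t) <= C * expR (- (d * n%:R))]) ->
  hausdorff_measure t S = 0%E.
Proof.
move=> t0 rad0 H; apply: hausdorff_measure_eq0 => delta e delta0 e0.
have [N1 radN1] := rad0 _ delta0.
have /choice[Kc Kc_spec] : forall n, exists Kc : nat * (X -> nat),
    (N0 <= n)%N -> [/\ Kc.1%:R <= w n, forall x, E n x -> (Kc.2 x < Kc.1)%N &
      forall x y, E n x -> E n y -> Kc.2 x = Kc.2 y -> mdist x y <= rad n].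
  move=> n; case: (leqP N0 n) => [/H[_ [K [c Kc]] _]|_]; last by exists (0%N, fun=> 0%N).
  by exists (K, c).
have Ka n : (N0 <= n)%N -> (Kc n).1%:R * rad n `^ t <= C * expR (- (d * n%:R)).
  move=> nN0; have [_ _] := H n nN0; apply: le_trans; rewrite ler_wpM2r ?powR_ge0//.
  by have [] := Kc_spec n nN0.
have [N NM Ne] := esum_geometric_tail d0 (fun n => powR_ge0 _ _) Ka (maxn N0 N1) e0.
apply: le_trans Ne.
pose U (p : nat * nat) := [set x | E p.1 x /\ (Kc p.1).2 x = p.2].
have Urad p : (N <= p.1)%N -> (diameter (U p) <= (rad p.1)%:E)%E.
  move=> Np; have [|_ _ cr] := Kc_spec p.1; first lia.
  have [|rp _ _] := H p.1; first lia.
  by apply: diameter_le => // x y [Ex cx] [Ey cy]; apply: cr => //; rewrite cx.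
apply: (@le_trans _ _ (\esum_(p in [set n | (N <= n)%N] `*`` (fun n => `I_((Kc n).1)))
    (diameter (U p) `^ t)%E)); last first.
  apply: le_esum => -[n j] [/= Nn _]; rewrite -poweR_EFin gt0_ler_poweR ?in_itv/= ?leey ?andbT//.
  - exact: diameter_ge0.
  - by rewrite lee_fin; have [|rn _ _] := H n; first lia.
  - exact: Urad.
apply: hausdorff_premeasure_le.
  move=> [n j] [/= Nn _]; apply: le_trans (Urad (n, j) Nn) _.
  by rewrite lee_fin; apply: radN1 => /=; lia.
move=> x Sx; have [n Nn Enx] := S_limsup Sx N.
have [|_ cK cr] := Kc_spec n; first lia.
by exists (n, (Kc n).2 x) => //=; split => //=; exact: cK.
Qed.

End NullSets.

(** * Compactness and the growth of the number of dynamical balls *)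

Lemma compact_cover_compact {T : topologicalType} (A : set T) :
  compact A -> cover_compact A.
Proof.
have [->|/set0P[x0 _]] := eqVneq A set0.
  by move=> _ I D h _ _; exists finmap.fset0.
(* A point of [A] turns [T] into a pointed space, to which [compact_cover] applies. *)
pose Tp : ptopologicalType := HB.pack (Topological.sort T) (isPointed.Build T x0).
move=> cA; change (@cover_compact Tp A); rewrite -compact_cover; exact: cA.
Qed.

Section EntropyBound.
Context {R : realType} {X : metricType R}.
Variable f : X -> X.

(* Growth of the number of dynamical balls at scale [eps]: an upper bound [s]
   for the classical (spanning set) entropy. *)
Definition entropy_bound (s eps : R) :=
  exists C : R, forall n, few_classes setT
    (fun x y => bowen_ball f n x eps y) (C * expR (s * n%:R)).

Lemma bowen_ball_trans n x y z eps : bowen_ball f n x eps y ->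
  bowen_ball f n x eps z -> bowen_ball f n y (2 * eps) z.
Proof.
move=> xy xz i ni; apply: le_lt_trans (metric_triangle _ (iter i f x) _) _.
by rewrite metric_sym mulr_natl mulr2n ltrD// ?xy// xz.
Qed.

Lemma bowen_ball_add m n x y eps : bowen_ball f m x eps y ->
  bowen_ball f n (iter m f x) eps (iter m f y) ->
  bowen_ball f (m + n) x eps y.
Proof.
move=> xym xyn i imn; case: (ltnP i m) => [/xym//|mi].
by have := xyn (i - m)%N; rewrite -!iterD subnK//; apply; lia.
Qed.

(* Concatenation: pieces of the cover are glued along orbits, and since the
   weights [expR (- s n_i)] add up to at most 1, so do those of the words. *)
Lemma entropy_bound_cover (I : eqType) (D : seq I) (c : I -> X) (m : I -> nat)
    (s eps : R) :
  0 <= s -> (forall i, i \in D -> (0 < m i)%N) ->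
  setT `<=` \bigcup_(i in [set` D]) bowen_ball f (m i) (c i) eps ->
  \sum_(i <- D) expR (- (s * (m i)%:R)) <= 1 ->
  entropy_bound s (2 * eps).
Proof.
move=> s0 m0 cov sum1; pose N := \max_(i <- D) m i.
have mN i : i \in D -> (m i <= N)%N by move=> iD; exact: leq_bigmax_seq.
have trivial0 x y : bowen_ball f 0 x (2 * eps) y by [].
(* The slack [N] absorbs the last piece of a word, whose order may exceed the time that remains. *)
suff H n : few_classes setT (fun x y => bowen_ball f n x (2 * eps) y)
    (if n is 0 then 1 else expR (s * (n%:R + N%:R))).
  exists (expR (s * N%:R)) => n; apply: few_classes_impl (H n) => //.
  rewrite -expRD -mulrDr addrC; case: n => // .
  by rewrite -[leLHS]expR0 ler_expR mulr_ge0.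
elim/ltn_ind: n => -[_|n IH].
  by exists 1%N, (fun=> 0%N); split => //; rewrite lexx.
apply: (@few_classes_impl _ _ (\bigcup_(i in [set` D]) bowen_ball f (m i) (c i) eps)
  _ (fun x y => bowen_ball f n.+1 x (2 * eps) y) _
  (\sum_(i <- D) expR (s * (n.+1%:R + N%:R)) * expR (- (s * (m i)%:R)))) => //.
  by rewrite -mulr_sumr ler_piMr ?expR_ge0.
apply: few_classes_bigcup => i iD.
have lt_n : (n.+1 - m i < n.+1)%N by have := m0 i iD; lia.
apply: few_classes_impl (few_classes_preimage (iter (m i) f) (IH _ lt_n)) => //.
  rewrite -expRD -mulrN -mulrDr; case E : (n.+1 - m i)%N => [|k].
    rewrite -[leLHS]expR0 ler_expR mulr_ge0// subr_ge0 -natrD ler_nat.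
    by have := mN i iD; lia.
  rewrite ler_expR ler_wpM2l// -E natrB; last lia.
  by lra.
move=> x y xi yi xy j jn.
by apply: (@bowen_ball_add (m i) (n.+1 - m i)); [exact: bowen_ball_trans xi yi|exact: xy|lia].
Qed.

Hypothesis X_compact : compact [set: X].

(** A finite subcover by balls of radius [eps / 2], read as dynamical balls of order 1, feeds the
    concatenation lemma. *)
Lemma entropy_bound_exists eps : 0 < eps -> exists2 s, 0 <= s & entropy_bound s eps.
Proof.
move=> e0; have := compact_cover_compact X_compact.
move=> /(_ X setT (fun x => (ball x (eps / 2))^°)) [].
- by move=> x _; exact: open_interior.
- by move=> x _; exists x => //; apply: nbhs_singleton; apply: nbhs_interior; apply: nbhsx_ballx; rewrite divr_gt0.
move=> D' _ cov; pose D : seq X := finmap.enum_fset D'.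
(* With the successor the weights sum to [size D / (size D + 1)], and the logarithm has a positive
   argument even for an empty subcover. *)
exists (ln (size D).+1%:R); first by rewrite ln_ge0// ler1n.
have -> : eps = 2 * (eps / 2) by lra.
apply: (@entropy_bound_cover X D id (fun=> 1%N)) => //.
- by rewrite ln_ge0// ler1n.
- move=> x /cov[y yD /interior_subset]; rewrite ballEmdist /= => yx.
  by exists y => // -[].
- rewrite big_const_seq count_predT iter_addr addr0 mulr1 expRN lnK ?posrE//.
  by rewrite -[_ *+ size D]mulr_natl ler_pdivrMr// mul1r ler_nat.
Qed.

Hypothesis f_cont : continuous f.

Lemma open_bowen_ball n x eps : open (bowen_ball f n x eps).
Proof.
have f_itercont i : continuous (iter i f).
  elim: i => [|i IH] y /=; first exact: cvg_id.
  by apply: continuous_comp; [exact: IH|exact: f_cont].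
elim: n => [|n IH].
  by rewrite (_ : bowen_ball _ _ _ _ = setT); [exact: openT|apply/seteqP; split].
rewrite (_ : bowen_ball f n.+1 x eps = bowen_ball f n x eps `&`
    (iter n f @^-1` ball (iter n f x) eps)).
  apply: openI => //; apply: open_comp => //.
  rewrite openE => y; rewrite ballEmdist/= => yx.
  have d0 : 0 < eps - mdist (iter n f x) y by rewrite subr_gt0.
  apply/nbhs_ballP; exists (eps - mdist (iter n f x) y) => //= u.
  rewrite !ballEmdist/= ltrBrDl; exact: le_lt_trans (metric_triangle _ _ _).
apply/seteqP; split => [y xy|y [xy]].
  by split => [i /ltnW|]; rewrite ?ballEmdist/=; [exact: xy|exact: xy].
rewrite /= ballEmdist /= => xyn i; rewrite ltnS leq_eqVlt => /orP[/eqP->//|].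
exact: xy.
Qed.

(** Links Bowen's definition on the whole space to ball counting: a null Bowen measure provides a
    cover of total weight below 1, and since dynamical balls are open, compactness makes it finite,
    ready for concatenation. *)
Lemma htop_scale_entropy_bound s eps :
  (htop_scale f setT eps < s%:E)%E -> entropy_bound s (2 * eps).
Proof.
move=> /ereal_inf_lt[_ [s' [s'0 null] <-]]; rewrite lte_fin => ss'.
have : (bowen_premeasure f s' eps setT 1 < 1)%E.
  apply: (@le_lt_trans _ _ 0%E); last exact: lte01.
  by rewrite -null bowen_measureE; apply: ereal_sup_ubound; exists 1%N.
move=> /ereal_inf_lt[_ [I [c [m [m1 cov ->]]]] sum1].
have := compact_cover_compact X_compact.
move=> /(_ nat I (fun i => bowen_ball f (m i) (c i) eps)) [] //.
  by move=> i _; exact: open_bowen_ball.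
move=> D DI covD.
apply: (@entropy_bound_cover _ (finmap.enum_fset D) c m) => //.
- by rewrite (le_trans s'0)// ltW.
- by move=> i /DI/set_mem; exact: m1.
rewrite -lee_fin; apply: le_trans (ltW sum1).
apply: (@le_trans _ _ (\sum_(i <- finmap.enum_fset D) expR (- (s' * (m i)%:R)))%:E).
  by rewrite lee_fin ler_sum// => i _; rewrite ler_expR lerN2 ler_wpM2r// ltW.
apply: esum_ge; exists [set` finmap.enum_fset D].
  by split => // i /= /DI/set_mem.
by rewrite -fsbig_seq ?finmap.fset_uniq// sumEFin.
Qed.

(** The whole space is the limsup of the constant sequence [setT], covered by balls of order [n] at
    level [n]. *)
Lemma htop_scale_le_entropy_bound (x0 : X) s eps : 0 <= s -> entropy_bound s eps ->
  (htop_scale f setT eps <= s%:E)%E.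
Proof.
move=> s0 [C few]; apply: htop_scale_le => // t st.
apply: (@bowen_measure_limsup _ _ _ (fun=> setT) (fun n => C * expR (s * n%:R)) C
   (t - s) 0 _ _ x0 _ _ _ id).
- by rewrite subr_gt0.
- by move=> x _ N; exists N.
- move=> n _; split => //.
  by rewrite -mulrA -expRD -mulNr -mulrDl -mulNr opprB.
Qed.

(** If [f] is non-expanding, closeness at time 0 persists forward; if its inverse is, closeness at
    time [n] persists backward. Either way the classes of order 1 suffice for every [n]. *)
Lemma entropy_bound0 (g : X -> X) eps : 0 < eps ->
  (forall x y, mdist (f x) (f y) <= mdist x y) \/
  (cancel f g /\ forall x y, mdist (g x) (g y) <= mdist x y) ->
  entropy_bound 0 eps.
Proof.
move=> e0 nonexp; have [s s0 [C few]] := entropy_bound_exists e0.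
exists (C * expR (s * 1)) => n; rewrite mul0r expR0 mulr1.
case: nonexp => [fne|[fK gne]].
  apply: few_classes_impl (few 1%N) => // x y _ _ /(_ 0%N isT)/= xy i _.
  elim: i => [//|i IH]; exact: le_lt_trans (fne _ _) _.
apply: few_classes_impl (few_classes_preimage (iter n f) (few 1%N)) => //.
move=> x y _ _ /(_ 0%N isT)/= xy i ni; move: xy.
(* Descent from time [n] to time [i], each step undoing one application of [f] by [g]. *)
rewrite -(subnKC (ltnW ni)) addnC !iterD.
elim: (n - i)%N => // k IH /= xy; apply: IH.
by apply: le_lt_trans xy; rewrite -{1}[iter k f _]fK -{1}[iter k f (iter i f y)]fK.
Qed.

Lemma htop_setT0 (x0 : X) : (forall eps, 0 < eps -> entropy_bound 0 eps) ->
  htop f setT = 0%E.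
Proof.
move=> H; apply/eqP; rewrite eq_le htop_ge0 andbT; apply: htop_le => eps e0.
exact: htop_scale_le_entropy_bound (H _ e0).
Qed.

(* When [G = 0] and the entropy is infinite, any bound at the fixed scale
   [eps] will do. *)
Lemma le_entropy_bound eps (Q : \bar R) G : 0 < eps -> 0 <= G ->
  (forall s t, 0 <= s -> entropy_bound s eps -> s * G < t -> (Q <= t%:E)%E) ->
  (Q <= G%:E * htop f setT)%E.
Proof.
move=> e0; rewrite le_eqVlt => /orP[/eqP<-|G0] H.
  have [s s0 bs] := entropy_bound_exists e0.
  rewrite mul0e; apply/lee_addgt0Pr => e e1; rewrite add0e; apply: (H s) => //.
  by rewrite mulr0.
have := htop_ge0 f setT; case htopX : (htop f setT) => [h| |] // h0; last first.
  by rewrite gt0_muley ?leey// lte_fin.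
rewrite lee_fin in h0; rewrite -EFinM; apply/lee_addgt0Pr => e e1; rewrite -EFinD.
have eG : 0 < e / 2 / G by rewrite !divr_gt0.
apply: (H (h + e / 2 / G)); first by rewrite addr_ge0// ltW.
  have -> : eps = 2 * (eps / 2) by lra.
  apply: htop_scale_entropy_bound.
  apply: le_lt_trans (htop_scale_le_htop _ _ _) _; first by rewrite divr_gt0.
  by rewrite htopX lte_fin ltrDl.
by rewrite mulrDl mulfVK ?gt_eqF// mulrC ltrD2l ltr_pdivrMr// ltr_pMr// ltr1n.
Qed.

(** At one fixed scale a ball of order [m] has diameter at most a constant times
    [expR (- (lambda * m))], so its diameter to a power [t > s / lambda] is eventually below its
    Bowen weight of exponent [s]. *)
Lemma hausdorff_dim_hyperbolic lambda Z : 0 < lambda -> hyperbolic lambda f ->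
  (hausdorff_dim Z <= (lambda^-1)%:E * htop f Z)%E.
Proof.
move=> l0 /(_ 1 ltr01)[eps [e0 _ hyp]].
apply: (@le_trans _ _ ((lambda^-1)%:E * htop_scale f Z eps)%E); last first.
  by rewrite lee_pmul2l// ?lte_fin ?invr_gt0// htop_scale_le_htop.
rewrite -lee_pdivrMl// ?invr_gt0// invrK.
apply: le_ereal_inf_tmp => _ [s [s0 null] <-].
rewrite -{1}[lambda]invrK lee_pdivrMl ?invr_gt0// -EFinM.
apply: hausdorff_dim_le => [|t]; first by rewrite mulr_ge0// invr_ge0 ltW.
rewrite ltr_pdivrMl// => st.
have t0 : 0 < t by rewrite -(pmulr_rgt0 _ l0) (le_lt_trans s0).
apply: hausdorff_measure_eq0 => delta e delta0 e1.
(* Beyond [N1] the diameters are at most [delta]; beyond [N2] the gap [lambda * t - s] absorbs the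
   constant. The factor 2 passes from radius to diameter, and [expR lambda] accounts for the last
   index being [m - 1]. *)
have [N1 diamN1] := exp_decay (2 * expR lambda) l0 delta0.
have b0 : 0 < lambda * t - s by rewrite subr_gt0.
have [N2 sumN2] := exp_decay ((2 * expR lambda) `^ t) b0 ltr01.
have : (bowen_premeasure f s eps Z (maxn 1 (maxn N1 N2)) < e%:E)%E.
  apply: (@le_lt_trans _ _ 0%E); last by rewrite lte_fin.
  by rewrite -null bowen_measureE; apply: ereal_sup_ubound; exists (maxn 1 (maxn N1 N2)).
move=> /ereal_inf_lt[_ [I [c [m [mN cov ->]]]] sum_e].
have diam_ball i : I i -> (diameter (bowen_ball f (m i) (c i) eps) <=
    (2 * expR lambda * expR (- (lambda * (m i)%:R)))%:E)%E.
  move=> Ii; apply: diameter_le => [|x y cx cy]; first by rewrite !mulr_ge0 ?expR_ge0.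
  have m1 : (1 <= m i)%N by have := mN i Ii; lia.
  have hc u : bowen_ball f (m i) (c i) eps u ->
      mdist (c i) u <= expR lambda * expR (- (lambda * (m i)%:R)).
    move=> /(hyp _ _ m1) /(_ 0%N isT)/ltW/le_trans; apply.
    rewrite mul1r subn0 -expRD ler_expR -subn1 natrB//; lra.
  apply: le_trans (metric_triangle _ (c i) _) _.
  by rewrite metric_sym -mulrA mulr_natl mulr2n lerD// hc.
apply: le_trans (ltW sum_e).
apply: (@le_trans _ _ (\esum_(i in I) (diameter (bowen_ball f (m i) (c i) eps) `^ t)%E)).
  apply: hausdorff_premeasure_le => // i Ii; apply: le_trans (diam_ball i Ii) _.
  by rewrite lee_fin diamN1//; have := mN i Ii; lia.
apply: le_esum => i Ii.
apply: (@le_trans _ _ ((2 * expR lambda * expR (- (lambda * (m i)%:R)))%:E `^ t)%E).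
  rewrite gt0_ler_poweR ?in_itv/= ?leey ?andbT ?diameter_ge0 ?lee_fin ?(ltW t0)//.
  exact: diam_ball.
rewrite poweR_EFin lee_fin powRM ?expR_ge0// ?mulr_ge0 ?expR_ge0// -expRM.
have mi : (N2 <= m i)%N by have := mN i Ii; lia.
have := ler_wpM2r (expR_ge0 (- (s * (m i)%:R))) (sumN2 _ mi).
rewrite mul1r -mulrA -expRD; apply: le_trans.
by rewrite ler_wpM2l ?powR_ge0// ler_expR; lra.
Qed.

End EntropyBound.

(** * Lipschitz estimates for iterates *)

Lemma lipschitz_const_le {R : realType} {X : metricType R} (f : X -> X) (L : R) :
  (lipschitz_const f <= L%:E)%E ->
  forall x y, mdist (f x) (f y) <= L * mdist x y.
Proof.
move=> fL x y; have [->|xy] := eqVneq x y; first by rewrite !mdistxx mulr0.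
rewrite -ler_pdivrMr ?mdist_gt0// -lee_fin; apply: le_trans fL.
by apply: ereal_sup_ubound; exists (x, y) => //=; exact/eqP.
Qed.

Lemma iter_lipschitz {R : realType} {X : metricType R} (f : X -> X) (L : R) :
  0 <= L -> (forall x y, mdist (f x) (f y) <= L * mdist x y) ->
  forall n x y, mdist (iter n f x) (iter n f y) <= L ^+ n * mdist x y.
Proof.
move=> L0 fL; elim=> [|n IH] x y; first by rewrite mul1r.
by apply: le_trans (fL _ _) _; rewrite exprS -mulrA ler_wpM2l ?IH.
Qed.

Lemma iter_cancel {T : Type} (f g : T -> T) n :
  cancel f g -> cancel (iter n f) (iter n g).
Proof. by move=> fK; elim: n => [|n IH] x //; rewrite iterSr /= fK IH. Qed.

Lemma nonexpanding_lipschitz {R : realType} {X : metricType R} (f : X -> X) (L : R) :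
  L <= 1 -> (forall x y, mdist (f x) (f y) <= L * mdist x y) ->
  forall x y, mdist (f x) (f y) <= mdist x y.
Proof.
by move=> L1 fL x y; apply: le_trans (fL x y) _; rewrite ler_piMl ?mdist_ge0.
Qed.

(** * Orbits near the time of a hit, and covers of the shrinking target set *)

Section ShrinkingTarget.
Context {R : realType} {X : metricType R}.
Variables (f : X -> X) (phi : nat -> R) (z : nat -> X).
Hypothesis phi_range : forall n, 0 < phi n /\ phi n <= 1.
Local Notation tau := (lower_decay_rate phi).
Local Notation S := (shrinking_target f phi z).

Definition hit (n : nat) : set X := [set x | mdist (iter n f x) (z n) < phi n].

Lemma shrinking_target_limsup x : S x -> forall N, exists2 n, (N <= n)%N & hit n x.
Proof.
move=> Sx N; apply: contrapT => noN; apply: Sx.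
apply: (sub_finite_set _ (finite_II N)) => n /= nx.
by rewrite ltnNge; apply/negP => Nn; apply: noN; exists n.
Qed.

Lemma hit_dist n x y : hit n x -> hit n y ->
  mdist (iter n f x) (iter n f y) <= 2 * phi n.
Proof.
move=> nx ny; apply: le_trans (metric_triangle _ (z n) _) _.
by rewrite mulr_natl mulr2n [mdist (z n) _]metric_sym lerD// ltW.
Qed.

Lemma lower_decay_rateE : tau =
  ereal_sup (range (einfs (fun n : nat => (- (ln (phi n) / n%:R))%:E))).
Proof.
by rewrite /lower_decay_rate limn_einf_lim; apply/cvg_lim => //; exact: cvg_einfs_sup.
Qed.

Lemma lower_decay_rate_ge0 : (0 <= tau)%E.
Proof.
rewrite lower_decay_rateE.
apply: (@le_trans _ _ (einfs (fun n : nat => (- (ln (phi n) / n%:R))%:E) 0));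
  last by apply: ereal_sup_ubound; exists 0%N.
apply: le_ereal_inf_tmp => _ [n _ <-]; rewrite lee_fin oppr_ge0.
by rewrite mulr_le0_ge0 ?invr_ge0// ln_le0; case: (phi_range n).
Qed.

Lemma lower_decay_rate_lt (r : R) : (r%:E < tau)%E ->
  exists N, forall n, (N <= n)%N -> phi n <= expR (- (r * n%:R)).
Proof.
(* The successor keeps [n] positive, away from the quotient by zero. *)
rewrite lower_decay_rateE => /ereal_sup_gt[_ [N _ <-] rN]; exists N.+1 => n Nn.
have n0 : 0 < n%:R :> R by rewrite ltr0n; lia.
rewrite -[phi n]lnK ?posrE; last by case: (phi_range n).
have : r < - (ln (phi n) / n%:R).
  rewrite -lte_fin; apply: lt_le_trans rN _; apply: ereal_inf_lbound.
  by exists n => //=; lia.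
by rewrite -mulNr ltr_pdivlMr// ler_expR; lra.
Qed.

(* An orbit segment of length [theta n] expanded by [L] at each step stays
   exponentially short when it ends in the [n]-th target. *)
Lemma expanded_target (L theta : R) : 1 <= L -> 0 <= theta ->
  ((theta * ln L)%:E < tau)%E ->
  exists2 d, 0 < d & exists N, forall n, (N <= n)%N -> forall j : nat,
    j%:R <= theta * n%:R -> L ^+ j * (2 * phi n) <= 2 * expR (- (d * n%:R)).
Proof.
move=> L1 th0 lt_tau.
(* The room between [theta * ln L] and [r] becomes the decay rate [d]. *)
have [r thr rtau] : exists2 r, theta * ln L < r & (r%:E < tau)%E.
  move: lt_tau; case: tau => [t| |]//; last first.
    by move=> _; exists (theta * ln L + 1); [rewrite ltrDl|rewrite ltry].
  rewrite lte_fin => lt_t; exists ((theta * ln L + t) / 2); first lra.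
  by rewrite lte_fin; lra.
exists (r - theta * ln L); first by rewrite subr_gt0.
have [N phiN] := lower_decay_rate_lt rtau; exists N => n /phiN phin j jn.
rewrite mulrCA ler_wpM2l//.
have lnL : 0 <= ln L by rewrite ln_ge0.
have -> : L ^+ j = expR (ln L * j%:R).
  by rewrite expRM_natr lnK// posrE; lra.
apply: (@le_trans _ _ (expR (ln L * (theta * n%:R)) * expR (- (r * n%:R)))).
  by rewrite ler_pM ?expR_ge0 ?(ltW (phi_range n).1)// ler_expR ler_wpM2l.
by rewrite -expRD ler_expR; lra.
Qed.

Definition close_before (kappa eps : R) :=
  exists N, forall n, (N <= n)%N -> forall x y, hit n x -> hit n y ->
  forall i, (n - Num.truncn (kappa * n%:R) <= i < n)%N ->
  mdist (iter i f x) (iter i f y) < eps.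

Definition close_after (mu eps : R) :=
  exists N, forall n, (N <= n)%N -> forall x y, hit n x -> hit n y ->
  forall j, (j < Num.truncn (mu * n%:R))%N ->
  mdist (iter (n + j) f x) (iter (n + j) f y) < eps.

Lemma close_before0 eps : close_before 0 eps.
Proof. by exists 0%N => n _ x y _ _ i; rewrite mul0r truncn0; lia. Qed.

Lemma close_after0 eps : close_after 0 eps.
Proof. by exists 0%N => n _ x y _ _ j; rewrite mul0r truncn0. Qed.

Lemma close_before_lt (g : X -> X) (L kappa eps : R) : cancel f g ->
  (forall x y, mdist (g x) (g y) <= L * mdist x y) -> 1 <= L ->
  0 <= kappa -> ((kappa * ln L)%:E < tau)%E -> 0 < eps ->
  close_before kappa eps.
Proof.
move=> fK gL L1 k0 /(expanded_target L1 k0)[d d0 [N HN]] e0.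
have e20 : 0 < eps / 2 by rewrite divr_gt0.
have [N' HN'] := exp_decay 2 d0 e20.
exists (maxn N N') => n Nn x y nx ny i /andP[ni lt_in].
have iE (u : X) : iter i f u = iter (n - i) g (iter n f u).
  by rewrite -{2}(subnK (ltnW lt_in)) iterD iter_cancel.
rewrite !iE.
have L0 : 0 <= L by lra.
have j_le : (n - i)%N%:R <= kappa * n%:R.
  apply: (@le_trans _ _ (Num.truncn (kappa * n%:R))%:R); first by rewrite ler_nat; lia.
  by rewrite truncn_le mulr_ge0.
apply: le_lt_trans (iter_lipschitz L0 gL _ _ _) _.
apply: (@le_lt_trans _ _ (eps / 2)); last by rewrite ltr_pdivrMr// ltr_pMr// ltr1n.
apply: le_trans (HN' n _); last lia.
apply: le_trans (HN n _ _ j_le); last lia.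
by rewrite ler_wpM2l ?exprn_ge0// hit_dist.
Qed.

Lemma close_after_lt (L mu eps : R) :
  (forall x y, mdist (f x) (f y) <= L * mdist x y) -> 1 <= L ->
  0 <= mu -> ((mu * ln L)%:E < tau)%E -> 0 < eps -> close_after mu eps.
Proof.
move=> fL L1 m0 /(expanded_target L1 m0)[d d0 [N HN]] e0.
have e20 : 0 < eps / 2 by rewrite divr_gt0.
have [N' HN'] := exp_decay 2 d0 e20.
exists (maxn N N') => n Nn x y nx ny j jm.
rewrite addnC !iterD.
have L0 : 0 <= L by lra.
have j_le : j%:R <= mu * n%:R.
  apply: (@le_trans _ _ (Num.truncn (mu * n%:R))%:R); first by rewrite ler_nat; lia.
  by rewrite truncn_le mulr_ge0.
apply: le_lt_trans (iter_lipschitz L0 fL _ _ _) _.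
apply: (@le_lt_trans _ _ (eps / 2)); last by rewrite ltr_pdivrMr// ltr_pMr// ltr1n.
apply: le_trans (HN' n _); last lia.
apply: le_trans (HN n _ _ j_le); last lia.
by rewrite ler_wpM2l ?exprn_ge0// hit_dist.
Qed.

(** Shortening a window by [theta < 1] makes the rate inequality strict, as the exponential bound on
    [phi] requires. *)
Lemma scaled_lt_rate (l a theta : R) : 0 < l -> 0 < a -> theta < 1 ->
  ((a * l)%:E <= tau)%E -> ((theta * a * l)%:E < tau)%E.
Proof.
move=> l0 a0 th1; apply: lt_le_trans.
by rewrite lte_fin -mulrA gtr_pMl// mulr_gt0.
Qed.

(** The case [a = 0] is separate: its window is empty, while the strict rate inequality would fail
    for [tau = 0]. *)
Lemma close_before_le (g : X -> X) (L a theta eps : R) : cancel f g ->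
  (forall x y, mdist (g x) (g y) <= L * mdist x y) -> 1 < L ->
  0 <= a -> ((a * ln L)%:E <= tau)%E -> 0 <= theta -> theta < 1 -> 0 < eps ->
  close_before (theta * a) eps.
Proof.
move=> fK gL L1; rewrite le_eqVlt => /orP[/eqP<- *|a0 atau th0 th1 e0].
  by rewrite mulr0; exact: close_before0.
apply: (close_before_lt fK gL) => //; [exact: ltW|by rewrite mulr_ge0// ltW|].
by apply: scaled_lt_rate => //; rewrite ln_gt0.
Qed.

Lemma close_after_le (L a theta eps : R) :
  (forall x y, mdist (f x) (f y) <= L * mdist x y) -> 1 < L ->
  0 <= a -> ((a * ln L)%:E <= tau)%E -> 0 <= theta -> theta < 1 -> 0 < eps ->
  close_after (theta * a) eps.
Proof.
move=> fL L1; rewrite le_eqVlt => /orP[/eqP<- *|a0 atau th0 th1 e0].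
  by rewrite mulr0; exact: close_after0.
apply: (close_after_lt fL) => //; [exact: ltW|by rewrite mulr_ge0// ltW|].
by apply: scaled_lt_rate => //; rewrite ln_gt0.
Qed.

(** Two hits need to be told apart only up to the start of the backward window; from there on they
    are close anyway. *)
Lemma few_classes_hit (s eps kappa mu C : R) :
  (forall n, few_classes setT (fun x y => bowen_ball f n x eps y)
    (C * expR (s * n%:R))) ->
  close_before kappa eps -> close_after mu eps ->
  exists N, forall n, (N <= n)%N -> few_classes (hit n)
    (fun x y => bowen_ball f (n + Num.truncn (mu * n%:R)) x eps y)
    (C * expR (s * (n - Num.truncn (kappa * n%:R))%N%:R)).
Proof.
move=> few [N1 HN1] [N2 HN2]; exists (maxn N1 N2) => n Nn.
apply: few_classes_impl (few (n - Num.truncn (kappa * n%:R))%N) => //.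
move=> x y nx ny xy i im; case: (ltnP i (n - Num.truncn (kappa * n%:R))) => [|ki].
  exact: xy.
case: (ltnP i n) => [lt_in|ni]; first by apply: (HN1 n); [lia|..|rewrite ki].
by rewrite -(subnKC ni); apply: (HN2 n); [lia|..|lia].
Qed.

Lemma truncn_sub_le (kappa : R) (n : nat) : 0 <= kappa <= 1 ->
  (n - Num.truncn (kappa * n%:R))%N%:R <= (1 - kappa) * n%:R + 1 :> R.
Proof.
move=> /andP[k0 k1]; have := truncnS_gt (kappa * n%:R).
have : (Num.truncn (kappa * n%:R))%:R <= n%:R :> R.
  apply: (@le_trans _ _ (kappa * n%:R)); first by rewrite truncn_le mulr_ge0.
  by rewrite ler_piMl.
by rewrite ler_nat => /natrB ->; rewrite -natr1; lra.
Qed.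

Lemma truncn_add_ge (mu : R) (n : nat) :
  (1 + mu) * n%:R - 1 <= (n + Num.truncn (mu * n%:R))%N%:R :> R.
Proof. by have := truncnS_gt (mu * n%:R); rewrite natrD -natr1; lra. Qed.

(** About [expR (s * (1 - kappa) * n)] balls, each of weight about [expR (- (t * (1 + mu) * n))],
    cover the hits at time [n]. *)
Lemma bowen_measure_target (s t eps kappa mu : R) :
  0 <= s -> 0 <= kappa <= 1 -> 0 <= mu -> entropy_bound f s eps ->
  close_before kappa eps -> close_after mu eps ->
  s * (1 - kappa) < t * (1 + mu) -> bowen_measure f t eps S = 0%E.
Proof.
move=> s0 k01 m0 [C few] before after st.
have C0 : 0 <= C by have [K [c [+ _ _]]] := few 0%N; rewrite mulr0 expR0 mulr1; exact: le_trans.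
have t0 : 0 <= t.
  rewrite -(pmulr_lge0 _ (_ : 0 < 1 + mu)); last lra.
  by apply: le_trans (ltW st); rewrite mulr_ge0//; lra.
have [N HN] := few_classes_hit few before after.
(* The factor [expR (s + t)] pays for rounding both window lengths. *)
apply: (@bowen_measure_limsup _ _ _ hit _ (C * expR (s + t))
   (t * (1 + mu) - s * (1 - kappa)) N _ shrinking_target_limsup (z 0) _ _ _
   (fun n => n + Num.truncn (mu * n%:R))%N) => [|n Nn]; first by rewrite subr_gt0.
split; [lia|exact: HN|].
rewrite -!mulrA ler_wpM2l// -!expRD ler_expR.
have := ler_wpM2l s0 (truncn_sub_le n k01).
have := ler_wpM2l t0 (truncn_add_ge mu n); lra.
Qed.

(* Pulling the piece back by [p ~ (n + m) lambda2 / lambda1] steps puts it in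
   the middle of a dynamical ball of order [p + n + m], where two-sided
   hyperbolicity makes it small. *)
Lemma hausdorff_measure_target (g : X -> X) (lambda1 lambda2 s t eps kappa mu : R) :
  cancel g f -> 0 < lambda1 -> 0 < lambda2 ->
  (forall (x : X) (n : nat), (1 <= n)%N -> forall y, bowen_ball f n x eps y ->
    forall i : nat, (i <= n.-1)%N -> mdist (iter i f x) (iter i f y) <
      1 * expR (- Num.min (i%:R * lambda1) ((n.-1 - i)%:R * lambda2))) ->
  0 <= s -> 0 <= kappa <= 1 -> 0 <= mu -> entropy_bound f s eps ->
  close_before kappa eps -> close_after mu eps ->
  s * (1 - kappa) < (t * lambda2 - s * lambda2 / lambda1) * (1 + mu) ->
  hausdorff_measure t S = 0%E.
Proof.
move=> gK l10 l20 hyp s0 k01 m0 [C few] before after st.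
have C0 : 0 <= C by have [K [c [+ _ _]]] := few 0%N; rewrite mulr0 expR0 mulr1; exact: le_trans.
pose G := t * lambda2 - s * lambda2 / lambda1.
have G0 : 0 <= G.
  rewrite -(pmulr_lge0 _ (_ : 0 < 1 + mu)); last lra.
  by apply: le_trans (ltW st); rewrite mulr_ge0//; lra.
have sl0 : 0 <= s * lambda2 / lambda1 by rewrite divr_ge0 ?mulr_ge0// ltW.
have t0 : 0 <= t by rewrite -(pmulr_lge0 _ l20) (le_trans sl0)// -subr_ge0.
have [N HN] := few_classes_hit few before after.
pose q n := (n + Num.truncn (mu * n%:R))%N.
(* Rounded up so that [p n * lambda1] exceeds [q n * lambda2] and the minimum in the hyperbolic
   estimate is the forward term. *)
pose p n := (Num.truncn ((q n)%:R * lambda2 / lambda1)).+1.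
(* After index [p n] a ball of order [p n + q n] has [q n - 1] steps left, whence the factor
   [expR lambda2]. *)
pose rad n := expR lambda2 * expR (- (lambda2 * (q n)%:R)).
pose w n := C * expR (s * (p n)%:R) *
  (C * expR (s * (n - Num.truncn (kappa * n%:R))%N%:R)).
(* In the constant, [s + s] rounds [p n] and the backward window, [lambda2 * t] comes from [rad],
   and [G] rounds the forward window. *)
apply: (@hausdorff_measure_limsup _ _ _ hit w (C * C * expR (s + s + lambda2 * t + G))
   (G * (1 + mu) - s * (1 - kappa)) (maxn 1 N) _ shrinking_target_limsup t rad t0).
- by rewrite subr_gt0.
- move=> delta d0; have [N' HN'] := exp_decay (expR lambda2) l20 d0.
  exists N' => n /HN'; apply: le_trans; rewrite ler_wpM2l ?expR_ge0// ler_expR lerN2.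
  by rewrite ler_wpM2l ?(ltW l20)// ler_nat leq_addr.
move=> n; rewrite geq_max => /andP[n1 nN]; split.
- by rewrite mulr_ge0 ?expR_ge0.
- apply: few_classes_impl (few_classes_and
      (few_classes_impl (E' := hit n) _ (lexx _) (fun x y _ _ => id)
        (few_classes_preimage (iter (p n) g) (few (p n)))) (HN n nN)) => //.
  move=> x y nx ny [pxy qxy].
  have xyp : bowen_ball f (p n + q n) (iter (p n) g x) eps (iter (p n) g y).
    by apply: bowen_ball_add => //; rewrite !iter_cancel.
  have q1 : (0 < q n)%N by rewrite addn_gt0 n1.
  have pq : (p n + q n).-1 = (p n + (q n - 1))%N by rewrite -subn1 addnBA.
  have := hyp _ _ _ _ xyp (p n); rewrite !iter_cancel// mul1r => H.
  apply: le_trans (ltW (H _ _)) _; [by rewrite addn_gt0 q1 orbT|by rewrite pq leq_addr|].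
  rewrite /rad -expRD ler_expR lerNl opprD opprK le_min; apply/andP; split.
    have := truncnS_gt ((q n)%:R * lambda2 / lambda1); rewrite -/(p n).
    rewrite ltr_pdivrMr//; lra.
  by rewrite pq addKn natrB//; lra.
rewrite /rad -expRD -expRM /w mulrACA -!mulrA !ler_wpM2l// -!expRD ler_expR.
have := ler_wpM2l s0 (truncn_sub_le n k01).
have := ler_wpM2l G0 (truncn_add_ge mu n); rewrite -/(q n).
have : s * (p n)%:R <= s * lambda2 / lambda1 * (q n)%:R + s.
  have : (p n)%:R <= (q n)%:R * lambda2 / lambda1 + 1.
    by rewrite /p -natr1 lerD2r truncn_le divr_ge0 ?mulr_ge0// ltW.
  by move=> /(ler_wpM2l s0); lra.
rewrite /G; lra.
Qed.

End ShrinkingTarget.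

(** * Perturbation of the exponent condition, and criteria for dimension zero *)

Lemma interior_fraction {R : realFieldType} (s G a1 a2 : R) :
  0 <= s -> 0 <= G -> 0 <= a1 -> 0 <= a2 -> s * (1 - a1) < G * (1 + a2) ->
  exists theta, [/\ 0 <= theta, theta < 1 &
    s * (1 - theta * a1) < G * (1 + theta * a2)].
Proof.
move=> s0 G0 a10 a20 sG; pose D := G * (1 + a2) - s * (1 - a1).
have D0 : 0 < D by rewrite subr_gt0.
pose K := G * a2 + s * a1; have K0 : 0 <= K by rewrite addr_ge0// mulr_ge0.
have DK : 0 < D + K by lra.
(* The difference of the two sides is affine in [theta] with slope [K] and value [D] at 1; here it
   equals [D ^+ 2 / (D + K)]. *)
exists (K / (D + K)); split; first by rewrite divr_ge0// ltW.
  by rewrite ltr_pdivrMr// mul1r ltrDr.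
rewrite -subr_gt0.
have -> : G * (1 + K / (D + K) * a2) - s * (1 - K / (D + K) * a1) = D ^+ 2 / (D + K).
  have -> : D ^+ 2 = (G - s) * (D + K) + K * K.
    by rewrite /D /K; ring.
  by rewrite [RHS]mulrDl mulfK ?gt_eqF// /K; ring.
by rewrite divr_gt0// exprn_gt0.
Qed.

(** Boundedly many pieces per level, of exponentially small diameter, have summable diameters to any
    power [t > 0]. *)
Lemma hausdorff_dim_limsup0 {R : realType} {X : metricType R} (S : set X)
    (E : nat -> set X) (W D b : R) (N0 : nat) :
  (forall x, S x -> forall N, exists2 n, (N <= n)%N & E n x) ->
  0 <= D -> 0 < b ->
  (forall n, (N0 <= n)%N ->
    few_classes (E n) (fun x y => mdist x y <= D * expR (- (b * n%:R))) W) ->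
  hausdorff_dim S = 0%E.
Proof.
move=> SE D0 b0 few; apply/eqP; rewrite eq_le hausdorff_dim_ge0 andbT.
apply: hausdorff_dim_le => // t t0.
apply: (@hausdorff_measure_limsup _ _ _ E (fun=> W) (W * D `^ t) (b * t) N0 _ SE t
  (fun n => D * expR (- (b * n%:R)))).
- by rewrite mulr_gt0.
- exact: ltW.
- by move=> delta d0; exact: exp_decay.
- move=> n /few fewn; split => //; first by rewrite mulr_ge0 ?expR_ge0.
  by rewrite powRM ?expR_ge0// -expRM -mulrA mulNr mulrAC.
Qed.

(** The images under [iter n g] of a fixed finite partition into small pieces cover the space and
    shrink exponentially. *)
Lemma hausdorff_dim_contraction {R : realType} {X : metricType R}
    (f g : X -> X) (L : R) (S : set X) :
  compact [set: X] -> cancel f g -> L < 1 ->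
  (forall x y, mdist (g x) (g y) <= L * mdist x y) -> hausdorff_dim S = 0%E.
Proof.
move=> X_compact fK L1 gL.
have [s s0 [C few]] := entropy_bound_exists f X_compact ltr01.
(* [L] may be zero or negative; its logarithm is needed as a rate. *)
pose L' := Num.max L (1 / 2).
have L'0 : 0 < L' by rewrite lt_max; apply/orP; right; lra.
have L'1 : L' < 1 by rewrite gt_max L1/=; lra.
have gL' x y : mdist (g x) (g y) <= L' * mdist x y.
  by apply: le_trans (gL x y) _; rewrite ler_wpM2r ?mdist_ge0// le_max lexx.
apply: (@hausdorff_dim_limsup0 _ _ _ (fun=> setT) (C * expR (s * 1)) 1 (- ln L') 0).
- by move=> x _ N; exists N.
- exact: ler01.
- by rewrite oppr_gt0 ln_lt0// L'0.
- move=> n _; apply: few_classes_impl (few_classes_preimage (iter n f) (few 1%N)) => //.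
  move=> x y _ _ /(_ 0%N isT)/= xy.
  rewrite mul1r mulNr opprK expRM_natr lnK//.
  rewrite -[x in leLHS](iter_cancel n fK) -[y in leLHS](iter_cancel n fK).
  apply: le_trans (iter_lipschitz (ltW L'0) gL' _ _ _) _.
  by rewrite ler_piMr ?exprn_ge0 ?ltW.
Qed.

(** * Entropy and dimension bounds from controlled windows *)

Section TargetBounds.
Context {R : realType} {X : metricType R}.
Variables (f : X -> X) (phi : nat -> R) (z : nat -> X).
Hypothesis X_compact : compact [set: X].
Hypothesis f_cont : continuous f.
Hypothesis phi_range : forall n, 0 < phi n /\ phi n <= 1.
Local Notation tau := (lower_decay_rate phi).
Local Notation S := (shrinking_target f phi z).

(* Visits at time [n] control the orbit from time about [(1 - a1) n] to time
   about [(1 + a2) n]. *)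
Definition controlled (a1 a2 : R) := forall theta eps,
  0 <= theta -> theta < 1 -> 0 < eps ->
  close_before f phi z (theta * a1) eps /\ close_after f phi z (theta * a2) eps.

(** The windows may depend on [s] and [t], which serves the case of an infinite decay rate. *)
Lemma htop_target_le F : 0 <= F ->
  (forall s t, 0 <= s -> s * F < t -> exists a1 a2,
    [/\ 0 <= a1 <= 1, 0 <= a2, controlled a1 a2 & s * (1 - a1) < t * (1 + a2)]) ->
  (htop f S <= F%:E * htop f setT)%E.
Proof.
move=> F0 HF; apply: htop_le => eps e0.
apply: (le_entropy_bound X_compact f_cont e0 F0) => s t s0 bs sFt.
have t0 : 0 <= t by rewrite (le_trans _ (ltW sFt))// mulr_ge0.
have [a1 [a2 [/andP[a10 a11] a20 ctl sa]]] := HF s t s0 sFt.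
have [theta [th0 th1 sth]] := interior_fraction s0 t0 a10 a20 sa.
have [before after] := ctl theta eps th0 th1 e0.
apply: ereal_inf_lbound; exists t => //; split => //.
apply: (bowen_measure_target s0 _ _ bs before after sth); last by rewrite mulr_ge0.
by rewrite mulr_ge0//= mulr_ile1// ltW.
Qed.

Lemma htop_controlled a1 a2 : 0 <= a1 <= 1 -> 0 <= a2 -> controlled a1 a2 ->
  (htop f S <= ((1 - a1) / (1 + a2))%:E * htop f setT)%E.
Proof.
move=> a101 a20 ctl; have a2p : 0 < 1 + a2 by lra.
apply: htop_target_le => [|s t s0 st]; first by rewrite divr_ge0 ?(ltW a2p)//; lra.
by exists a1, a2; split => //; rewrite -ltr_pdivrMr// -mulrA.
Qed.

(** The bound solves the exponent condition of [hausdorff_measure_target] for [t]: the first summand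
    pays for the backward extension, the second for the pieces of the hit set. *)
Lemma hausdorff_dim_controlled (g : X -> X) lambda1 lambda2 a1 a2 :
  cancel g f -> 0 < lambda1 -> 0 < lambda2 -> hyperbolic2 lambda1 lambda2 f ->
  0 <= a1 <= 1 -> 0 <= a2 -> controlled a1 a2 ->
  (hausdorff_dim S <=
    (lambda1^-1 + lambda2^-1 * ((1 - a1) / (1 + a2)))%:E * htop f setT)%E.
Proof.
move=> gK l10 l20 /(_ 1 ltr01)[eps [e0 _ hyp]] /andP[a10 a11] a20 ctl.
have a2p : 0 < 1 + a2 by lra.
have r0 : 0 <= lambda2^-1 * ((1 - a1) / (1 + a2)).
  by rewrite mulr_ge0 ?divr_ge0 ?invr_ge0 ?(ltW l20) ?(ltW a2p)//; lra.
apply: (le_entropy_bound X_compact f_cont e0).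
  by rewrite addr_ge0// invr_ge0 ltW.
move=> s t s0 bs st.
pose G := t * lambda2 - s * lambda2 / lambda1.
have sG : s * (1 - a1) < G * (1 + a2).
  rewrite -ltr_pdivrMr// -(ltr_pM2r (_ : 0 < lambda2^-1)) ?invr_gt0//.
  have -> : G / lambda2 = t - s / lambda1 by rewrite /G; field; rewrite !gt_eqF.
  rewrite ltrBrDl; move: st; congr (_ < _).
  by field; rewrite !gt_eqF.
have G0 : 0 <= G.
  by rewrite -(pmulr_lge0 _ a2p) (le_trans _ (ltW sG))// mulr_ge0//; lra.
have [theta [th0 th1 sth]] := interior_fraction s0 G0 a10 a20 sG.
have [before after] := ctl theta eps th0 th1 e0.
have t0 : 0 <= t.
  by rewrite (le_trans _ (ltW st))// mulr_ge0// addr_ge0// invr_ge0 ltW.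
apply: ereal_inf_lbound; exists t => //; split => //.
apply: (hausdorff_measure_target gK l10 l20 hyp s0 _ _ bs before after sth);
  last by rewrite mulr_ge0.
by rewrite mulr_ge0//= mulr_ile1// ltW.
Qed.

Lemma controlled00 : controlled 0 0.
Proof.
by move=> theta eps _ _ _; rewrite !mulr0; split;
  [exact: close_before0|exact: close_after0].
Qed.

(** Empty windows already bound the dimension by a finite multiple of the entropy. *)
Lemma hausdorff_dim_le_hyperbolic2 (g : X -> X) lambda1 lambda2 :
  cancel g f -> 0 < lambda1 -> 0 < lambda2 -> hyperbolic2 lambda1 lambda2 f ->
  htop f setT = 0%E -> (hausdorff_dim S <= 0)%E.
Proof.
move=> gK l10 l20 hyp h0.
have := hausdorff_dim_controlled gK l10 l20 hyp _ (lexx 0) controlled00.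
by rewrite h0 mule0; apply; rewrite lexx ler01.
Qed.

Lemma controlled1 (g : X -> X) L : cancel f g -> 1 <= L ->
  (forall x y, mdist (g x) (g y) <= L * mdist x y) ->
  ((ln L)%:E < tau)%E -> controlled 1 0.
Proof.
move=> fK L1 gL Ltau theta eps th0 th1 e0; rewrite mulr1 mulr0.
split; last exact: close_after0.
apply: (close_before_lt z phi_range fK gL) => //; apply: le_lt_trans Ltau.
by rewrite lee_fin ler_piMl ?ln_ge0// ltW.
Qed.

(** The [n]-th target shrinks faster than [n] inverse steps can expand it, so the whole hit set is
    one exponentially small piece. *)
Lemma hausdorff_dim_fast_target (g : X -> X) L : cancel f g -> 1 <= L ->
  (forall x y, mdist (g x) (g y) <= L * mdist x y) ->
  ((ln L)%:E < tau)%E -> hausdorff_dim S = 0%E.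
Proof.
move=> fK L1 gL; rewrite -[ln L]mul1r => /(expanded_target phi_range L1 ler01)[d d0 [N HN]].
apply: (@hausdorff_dim_limsup0 _ _ _ (hit f phi z) 1 2 d N) => //.
  exact: shrinking_target_limsup.
move=> n Nn; exists 1%N, (fun=> 0%N); split => // x y nx ny _.
apply: le_trans (HN n Nn n _); last by rewrite mul1r.
have L0 : 0 <= L by lra.
rewrite -[x in leLHS](iter_cancel n fK) -[y in leLHS](iter_cancel n fK).
apply: le_trans (iter_lipschitz L0 gL _ _ _) _.
by rewrite ler_wpM2l ?exprn_ge0// (hit_dist nx).
Qed.

End TargetBounds.

(** * Case analysis on the Lipschitz constants and the decay rate *)

Theorem theorem1p8 (R : realType) (X : metricType R)
    (X_compact : compact [set: X]) (X_two_points : exists x y : X, x <> y)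
    (f : X -> X) (f_cont : continuous f)
    (phi : nat -> R) (phi_range : forall n, 0 < phi n /\ phi n <= 1)
    (z : nat -> X) :
  let tau := lower_decay_rate phi in
  let S := shrinking_target f phi z in
  (forall L : R, lipschitz_map L f ->
     (htop f S <= (lipschitz_factor L tau)%:E * htop f setT)%E /\
     (forall lambda : R, 0 < lambda -> hyperbolic lambda f ->
        (hausdorff_dim S <=
           (lambda^-1 * lipschitz_factor L tau)%:E * htop f setT)%E)) /\
  (forall L1 L2 : R, bilipschitz_homeo L1 L2 f ->
     ((tau < (ln L1)%:E)%E ->
        (htop f S <=
           (bilipschitz_factor L1 L2 (fine tau))%:E * htop f setT)%E /\
        (forall lambda1 lambda2 : R, 0 < lambda1 -> 0 < lambda2 ->
           hyperbolic2 lambda1 lambda2 f ->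
           (hausdorff_dim S <=
              (lambda1^-1 +
               lambda2^-1 * bilipschitz_factor L1 L2 (fine tau))%:E *
              htop f setT)%E)) /\
     ((ln L1)%:E = tau ->
        htop f S = 0%E /\
        (forall lambda1 lambda2 : R, 0 < lambda1 -> 0 < lambda2 ->
           hyperbolic2 lambda1 lambda2 f ->
           (hausdorff_dim S <= (lambda1^-1)%:E * htop f setT)%E)) /\
     (((ln L1)%:E < tau)%E ->
        htop f S = 0%E /\
        (forall lambda1 lambda2 : R, 0 < lambda1 -> 0 < lambda2 ->
           hyperbolic2 lambda1 lambda2 f ->
           hausdorff_dim S = 0%E))).
Proof.
move=> tau S.
have tau0 : (0 <= tau)%E by exact: lower_decay_rate_ge0.
have zero_entropy (g : X -> X) :
    (forall x y, mdist (f x) (f y) <= mdist x y) \/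
    (cancel f g /\ forall x y, mdist (g x) (g y) <= mdist x y) ->
    htop f setT = 0%E /\ (htop f S <= 0)%E.
  move=> nonexp; have h0 : htop f setT = 0%E.
    by apply: (htop_setT0 (z 0)) => eps e0; exact: entropy_bound0 e0 nonexp.
  by split => //; rewrite -h0; exact: le_htop.
split=> [L /lipschitz_const_le fL|L1 L2 [g [[fK gK _ _] [gL fL]]]].
  have main : (htop f S <= (lipschitz_factor L tau)%:E * htop f setT)%E.
    have [L1|L1] := lerP L 1.
      have [h0 S0] := zero_entropy f (or_introl (nonexpanding_lipschitz L1 fL)).
      by rewrite h0 mule0.
    have l0 : 0 < ln L by rewrite ln_gt0.
    have ctl a : 0 <= a -> ((a * ln L)%:E <= tau)%E -> controlled f phi z 0 a.
      move=> a0 atau theta eps th0 th1 e0; split; first by rewrite mulr0; exact: close_before0.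
      exact: (close_after_le z phi_range fL).
    case tauE : tau tau0 ctl => [t| |] //= t0 ctl; last first.
      apply: htop_target_le => // s t s0; rewrite mulr0 => tp.
      (* For an infinite rate every forward window is controlled; this one gives
         [t * (1 + a2) = t + s > s]. *)
      exists 0, (s / t); split => //; first by rewrite lexx ler01.
      - by rewrite divr_ge0// ltW.
      - by apply: ctl; rewrite ?leey// divr_ge0// ltW.
      - have -> : t * (1 + s / t) = t + s by field; rewrite gt_eqF.
        lra.
    rewrite lee_fin in t0.
    have -> : 1 - t / (ln L + t) = (1 - 0) / (1 + t / ln L).
      by field; rewrite !gt_eqF//; lra.
    apply: htop_controlled => //; first by rewrite lexx ler01.
      by rewrite divr_ge0// ltW.
    by apply: ctl; [rewrite divr_ge0// ltW|rewrite divfK// gt_eqF].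
  split=> // lambda l0 hyp; apply: le_trans (hausdorff_dim_hyperbolic S l0 hyp) _.
  by rewrite EFinM -muleA lee_wpmul2l// lee_fin invr_ge0 ltW.
move/lipschitz_const_le in gL; move/lipschitz_const_le in fL.
have zeroL1 : L1 <= 1 -> htop f setT = 0%E /\ (htop f S <= 0)%E.
  by move=> L11; apply: (zero_entropy g); right; split => //;
    exact: nonexpanding_lipschitz gL.
split; [|split].
- case tauE : tau tau0 => [t| |] //= t0; rewrite lte_fin => tl1.
  rewrite lee_fin in t0.
  have l10 : 0 < ln L1 by lra.
  have L11 : 1 < L1 by rewrite ltNge; apply: contraTN l10 => /ln_le0; rewrite leNgt.
  (* For [L2 <= 1] the entropy of the space vanishes, whatever the value of the factor. *)
  have [L21|L21] := lerP L2 1.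
    have [h0 S0] := zero_entropy g (or_introl (nonexpanding_lipschitz L21 fL)).
    rewrite h0 !mule0; split => // lambda1 lambda2 la10 la20 hyp; rewrite mule0.
    exact: hausdorff_dim_le_hyperbolic2 gK la10 la20 hyp h0.
  have l20 : 0 < ln L2 by rewrite ln_gt0.
  have a10 : 0 <= t / ln L1 <= 1.
    by rewrite divr_ge0 ?(ltW l10)//= ler_pdivrMr// mul1r ltW.
  have a20 : 0 <= t / ln L2 by rewrite divr_ge0 ?(ltW l20).
  have ctl : controlled f phi z (t / ln L1) (t / ln L2).
    have [a10' _] := andP a10.
    move=> theta eps th0 th1 e0; split.
      apply: (close_before_le z phi_range fK gL) => //.
      by rewrite -/tau tauE divfK// gt_eqF.
    apply: (close_after_le z phi_range fL) => //.
    by rewrite -/tau tauE divfK// gt_eqF.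
  (* The factor is the ratio of ball orders for the windows [t / ln L1] and [t / ln L2]. *)
  have -> : bilipschitz_factor L1 L2 t = (1 - t / ln L1) / (1 + t / ln L2).
    have d0 : 0 < ln L2 + t by lra.
    have d1 : 0 < ln L1 * ln L2 + t * ln L1 by rewrite [t * _]mulrC -mulrDr mulr_gt0.
    by rewrite /bilipschitz_factor; field; rewrite !gt_eqF.
  split; first exact: htop_controlled.
  move=> lambda1 lambda2 la10 la20 hyp.
  exact: hausdorff_dim_controlled gK la10 la20 hyp a10 a20 ctl.
- move=> tauE.
  have le0 (Q : \bar R) : (0 <= Q)%E -> (Q <= 0)%E -> Q = 0%E.
    by move=> ? ?; apply/eqP; rewrite eq_le; apply/andP.
  have [L11|L11] := lerP L1 1.
    have [h0 S0] := zeroL1 L11; split; first by apply: le0 => //; exact: htop_ge0.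
    move=> lambda1 lambda2 la10 la20 hyp; rewrite h0 mule0.
    exact: hausdorff_dim_le_hyperbolic2 gK la10 la20 hyp h0.
  (* The backward window fills any fraction [theta < 1] of the time before the hit, so the term
     [1 - a1] vanishes. *)
  have ctl : controlled f phi z 1 0.
    move=> theta eps th0 th1 e0; split; last by rewrite mulr0; exact: close_after0.
    by apply: (close_before_le z phi_range fK gL) => //; rewrite mul1r tauE.
  have a01 : (0 <= 1 :> R) && (1 <= 1 :> R) by rewrite ler01 lexx.
  split.
    apply: le0; first exact: htop_ge0.
    by have := htop_controlled X_compact f_cont a01 (lexx 0) ctl; rewrite subrr mul0r mul0e.
  move=> lambda1 lambda2 la10 la20 hyp.
  have := hausdorff_dim_controlled X_compact f_cont gK la10 la20 hyp a01 (lexx 0) ctl.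
  by rewrite subrr mul0r mulr0 addr0.
- move=> tauE.
  (* For [L1 < 1] the inverse is a contraction; for [L1 >= 1] the targets outpace its expansion. *)
  have [L11|L11] := ltP L1 1.
    have [_ S0] := zeroL1 (ltW L11); split.
      by apply/eqP; rewrite eq_le S0 htop_ge0.
    by move=> *; exact: hausdorff_dim_contraction X_compact fK L11 gL.
  split; last by move=> *; exact: (hausdorff_dim_fast_target z phi_range fK L11 gL tauE).
  apply/eqP; rewrite eq_le htop_ge0 andbT.
  have a01 : (0 <= 1 :> R) && (1 <= 1 :> R) by rewrite ler01 lexx.
  have ctl := controlled1 z phi_range fK L11 gL tauE.
  by have := htop_controlled X_compact f_cont a01 (lexx 0) ctl; rewrite subrr mul0r mul0e.
Qed.
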